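(* Let $\mathcal{B}$ be a finite 2-category and $B$ a 0-cell of $\mathcal{B}$. The object $\mathcal{A}d_B$ of $Z(\mathcal{B})$, with product $m^B=(m^B_A)_A:\mathcal{A}d_B\otimes\mathcal{A}d_B\to\mathcal{A}d_B$ and unit $u^B=(u^B_A)_A:\mathbf 1\to\mathcal{A}d_B$, where for each 0-cell $A$ the 2-cells $m^B_A:\mathcal{L}(A,B)\circ\mathcal{L}(A,B)\to\mathcal{L}(A,B)$ and $u^B_A:I_A\to\mathcal{L}(A,B)$ are the unique ones satisfying $$\pi^{(A,B)}_X\,m^B_A=(\mathrm{id}_{{}^*X}\circ\mathrm{ev}_X\circ\mathrm{id}_X)(\pi^{(A,B)}_X\circ\pi^{(A,B)}_X),\qquad \pi^{(A,B)}_X\,u^B_A=\mathrm{coev}_X$$ for all $X\in\mathcal{B}(A,B)$, is an algebra in the center $Z(\mathcal{B})$.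
   Context: Throughout, $\Bbbk$ is an algebraically closed field; all (hom-)categories are abelian $\Bbbk$-linear and all functors additive $\Bbbk$-linear. 2-categories are strict; $\circ$ is horizontal composition, juxtaposition is vertical composition, $I_A$ is the identity 1-cell of $A$. A left dual of $X\in\mathcal{B}(A,B)$ is a 1-cell ${}^*X\in\mathcal{B}(B,A)$ with 2-cells $\mathrm{ev}_X:X\circ{}^*X\to I_B$, $\mathrm{coev}_X:I_A\to{}^*X\circ X$ satisfying the two triangle identities; a right dual $X^*$ is defined similarly with $X^*\circ X\to I_A$, $I_B\to X\circ X^*$. $\mathcal{B}$ is rigid if every 1-cell has left and right duals. A finite category is one equivalent to finite-dimensional modules over a finite-dimensional $\Bbbk$-algebra. A finite 2-category is a rigid 2-category with all $\mathcal{B}(A,B)$ finite and all $I_A$ simple in $\mathcal{B}(A,A)$. Center: objects of $Z(\mathcal{B})$ are pairs $(V,\sigma)$ with 1-cells $V_A\in\mathcal{B}(A,A)$ for each 0-cell $A$ and isomorphisms $\sigma_X:V_B\circ X\to X\circ V_A$ natural in $X\in\mathcal{B}(A,B)$, with $\sigma_{I_A}=\mathrm{id}$ and $\sigma_{X\circ Y}=(\mathrm{id}_X\circ\sigma_Y)(\sigma_X\circ\mathrm{id}_Y)$ for composable $X,Y$. Morphisms $f:(V,\sigma)\to(W,\tau)$ are families $f_A:V_A\to W_A$ with $(\mathrm{id}_X\circ f_A)\sigma_X=\tau_X(f_B\circ\mathrm{id}_X)$. The tensor product is $(V\otimes W)_A=V_A\circ W_A$, $(\sigma\otimes\tau)_X=(\sigma_X\circ\mathrm{id}_{W_A})(\mathrm{id}_{V_B}\circ\tau_X)$;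 the unit $\mathbf 1$ is $(I_A)_A$ with identity half-braiding. $\mathcal{L}(A,B)=\int_{X\in\mathcal{B}(A,B)}{}^*X\circ X\in\mathcal{B}(A,A)$ with universal dinatural maps $\pi^{(A,B)}_X:\mathcal{L}(A,B)\to{}^*X\circ X$. The object $\mathcal{A}d_B=((\mathcal{L}(A,B))_A,\sigma^B)\in Z(\mathcal{B})$ has half-braiding $\sigma^B_X:\mathcal{L}(A,B)\circ X\to X\circ\mathcal{L}(C,B)$, $X\in\mathcal{B}(C,A)$, the isomorphism with $\pi^{(A,B)}_Y\circ\mathrm{id}_X=(\mathrm{ev}_X\circ\mathrm{id}_{{}^*Y\circ Y\circ X})(\mathrm{id}_X\circ\pi^{(C,B)}_{Y\circ X})\sigma^B_X$ for all $Y\in\mathcal{B}(A,B)$ (using the canonical isomorphism ${}^*(Y\circ X)\simeq{}^*X\circ{}^*Y$). *)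

(* Defs.v *)
From mathcomp Require Import all_boot all_algebra.
From Stdlib Require Import ProofIrrelevance FunctionalExtensionality IndefiniteDescription.

Set Implicit Arguments.
Unset Strict Implicit.
Unset Printing Implicit Defensive.

Import GRing.Theory.
Local Open Scope ring_scope.

Record kcat (K : fieldType) := KCat {
  kobj :> Type;
  khom : kobj -> kobj -> lmodType K;
  kid : forall X, khom X X;
  kcomp : forall X Y Z, khom Y Z -> khom X Y -> khom X Z;
  kcompA : forall X Y Z T (h : khom Z T) (g : khom Y Z) (f : khom X Y),
    kcomp h (kcomp g f) = kcomp (kcomp h g) f;
  kcomp1l : forall X Y (f : khom X Y), kcomp (kid Y) f = f;
  kcompl1 : forall X Y (f : khom X Y), kcomp f (kid X) = f;
  kcomp_linearr : forall X Y Z (g : khom Y Z), linear (@kcomp X Y Z g);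
  kcomp_linearl : forall X Y Z (f : khom X Y),
    linear (fun g : khom Y Z => kcomp g f)
}.

Arguments kid {K} C X : rename.
Arguments kcomp {K C X Y Z} g f : rename.

Declare Scope cell_scope.
Delimit Scope cell_scope with cell.
Local Open Scope cell_scope.

Notation "X ~~> Y" := (khom X Y) (at level 70, no associativity) : cell_scope.
Notation "g \v f" := (kcomp g f) (at level 45, left associativity) : cell_scope.
Notation "\id_ X" := (kid _ X)
  (at level 8, X at level 8, format "\id_ X") : cell_scope.

Section LinearCategories.
Variables (K : fieldType) (C : kcat K).
Implicit Types X Y Z : C.

Definition is_iso X Y (f : X ~~> Y) : Prop :=
  exists g : Y ~~> X, g \v f = \id_X /\ f \v g = \id_Y.

Definition is_mono X Y (f : X ~~> Y) : Prop :=
  forall W (g h : W ~~> X), f \v g = f \v h -> g = h.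

Definition is_epi X Y (f : X ~~> Y) : Prop :=
  forall W (g h : Y ~~> W), g \v f = h \v f -> g = h.

Definition is_zero_obj Z : Prop :=
  (forall X (f g : Z ~~> X), f = g) /\ (forall X (f g : X ~~> Z), f = g).

Definition is_kernel X Y (f : X ~~> Y) W (k : W ~~> X) : Prop :=
  f \v k = 0 /\
  forall V (g : V ~~> X), f \v g = 0 -> exists! h : V ~~> W, k \v h = g.

Definition is_cokernel X Y (f : X ~~> Y) W (c : Y ~~> W) : Prop :=
  c \v f = 0 /\
  forall V (g : Y ~~> V), g \v f = 0 -> exists! h : W ~~> V, h \v c = g.

Definition is_biproduct X Y P
    (i1 : X ~~> P) (i2 : Y ~~> P) (p1 : P ~~> X) (p2 : P ~~> Y) : Prop :=
  [/\ p1 \v i1 = \id_X, p2 \v i2 = \id_Y, p1 \v i2 = 0, p2 \v i1 = 0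
    & i1 \v p1 + i2 \v p2 = \id_P].

Record is_abelian : Prop := IsAbelian {
  abelian_zero : exists Z, is_zero_obj Z;
  abelian_biproduct : forall X Y, exists P i1 i2 p1 p2,
    @is_biproduct X Y P i1 i2 p1 p2;
  abelian_kernel : forall X Y (f : X ~~> Y),
    exists W (k : W ~~> X), is_kernel f k;
  abelian_cokernel : forall X Y (f : X ~~> Y),
    exists W (c : Y ~~> W), is_cokernel f c;
  abelian_normal : forall W X (k : W ~~> X), is_mono k ->
    exists Y (f : X ~~> Y), is_kernel f k;
  abelian_conormal : forall Y W (c : Y ~~> W), is_epi c ->
    exists X (f : X ~~> Y), is_cokernel f c
}.

Definition is_simple S : Prop :=
  ~ is_zero_obj S /\
  forall X (i : X ~~> S), is_mono i -> is_zero_obj X \/ is_iso i.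

(** Since [algType] excludes the zero ring, whose category of modules (the
    zero category) is finite, a K-algebra is given here by a possibly trivial
    ring [A] and a central ring morphism [iota : K -> A]; K then acts on an
    [A]-module through [iota]. *)
Definition finite_dim (A : pzRingType) (iota : {rmorphism K -> A})
    (V : lmodType A) : Prop :=
  exists (n : nat) (e : 'I_n -> V),
    forall v, exists c : 'I_n -> K, v = \sum_(i < n) iota (c i) *: e i.

Definition is_fd_algebra (A : pzRingType) (iota : {rmorphism K -> A}) : Prop :=
  (forall c a, iota c * a = a * iota c) /\ @finite_dim A iota A^o.

Record module_equivalence (A : pzRingType) (iota : {rmorphism K -> A}) :=
    ModuleEquivalence {
  meq_obj : C -> lmodType A;
  meq_hom : forall X Y, X ~~> Y -> {linear meq_obj X -> meq_obj Y};
  meq_fd : forall X, finite_dim iota (meq_obj X);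
  meq_id : forall X, meq_hom \id_X =1 id;
  meq_comp : forall X Y Z (g : Y ~~> Z) (f : X ~~> Y),
    meq_hom (g \v f) =1 meq_hom g \o meq_hom f;
  meq_linear : forall X Y (c : K) (f g : X ~~> Y) v,
    meq_hom (c *: f + g) v = iota c *: meq_hom f v + meq_hom g v;
  meq_faithful : forall X Y (f g : X ~~> Y), meq_hom f =1 meq_hom g -> f = g;
  meq_full : forall X Y (h : {linear meq_obj X -> meq_obj Y}),
    exists f : X ~~> Y, meq_hom f =1 h;
  meq_esssurj : forall V : lmodType A, finite_dim iota V ->
    exists X (h : {linear meq_obj X -> V}), bijective h
}.

Definition is_finite : Prop :=
  exists (A : pzRingType) (iota : {rmorphism K -> A}),
    is_fd_algebra iota /\ inhabited (module_equivalence iota).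

(** Identity 2-cells between equal 1-cells: horizontal composition is strict,
    but only up to a propositional equality of 1-cells, and these cells
    mediate between the corresponding types. *)
Definition eq_hom X Y (e : X = Y) : X ~~> Y :=
  match e in _ = Z return X ~~> Z with erefl => \id_X end.

End LinearCategories.

Record tcat (K : fieldType) := TCat {
  cell0 :> Type;
  hcat : cell0 -> cell0 -> kcat K;
  one1 : forall A, hcat A A;
  hc1 : forall A B C, hcat B C -> hcat A B -> hcat A C;
  hc2 : forall A B C (X X' : hcat B C) (Y Y' : hcat A B),
    X ~~> X' -> Y ~~> Y' -> hc1 X Y ~~> hc1 X' Y';
  hc2_id : forall A B C (X : hcat B C) (Y : hcat A B),
    hc2 \id_X \id_Y = \id_(hc1 X Y);
  hc2_comp : forall A B C (X X' X'' : hcat B C) (Y Y' Y'' : hcat A B)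
      (f' : X' ~~> X'') (f : X ~~> X') (g' : Y' ~~> Y'') (g : Y ~~> Y'),
    hc2 (f' \v f) (g' \v g) = hc2 f' g' \v hc2 f g;
  hc2_linearr : forall A B C (X X' : hcat B C) (Y Y' : hcat A B)
    (f : X ~~> X'), linear (fun g : Y ~~> Y' => hc2 f g);
  hc2_linearl : forall A B C (X X' : hcat B C) (Y Y' : hcat A B)
    (g : Y ~~> Y'), linear (fun f : X ~~> X' => hc2 f g);
  hcA : forall A B C D (X : hcat C D) (Y : hcat B C) (Z : hcat A B),
    hc1 X (hc1 Y Z) = hc1 (hc1 X Y) Z;
  hc1l : forall A B (X : hcat A B), hc1 (one1 B) X = X;
  hcl1 : forall A B (X : hcat A B), hc1 X (one1 A) = X;
  hc2A : forall A B C D (X X' : hcat C D) (Y Y' : hcat B C) (Z Z' : hcat A B)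
      (f : X ~~> X') (g : Y ~~> Y') (h : Z ~~> Z'),
    eq_hom (hcA X' Y' Z') \v hc2 f (hc2 g h) =
    hc2 (hc2 f g) h \v eq_hom (hcA X Y Z);
  hc21l : forall A B (X X' : hcat A B) (f : X ~~> X'),
    eq_hom (hc1l X') \v hc2 \id_(one1 B) f = f \v eq_hom (hc1l X);
  hc2l1 : forall A B (X X' : hcat A B) (f : X ~~> X'),
    eq_hom (hcl1 X') \v hc2 f \id_(one1 A) = f \v eq_hom (hcl1 X)
}.

Arguments hcat {K} B A C : rename.
Arguments one1 {K B} A : rename.
Arguments hc1 {K B A C D} X Y : rename.
Arguments hc2 {K B A C D X X' Y Y'} f g : rename.

Notation "'\I_' A" := (one1 A) (at level 8, A at level 8, format "\I_ A")
  : cell_scope.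
Notation "X \h Y" := (hc1 X Y) (at level 40, left associativity) : cell_scope.
Notation "f \hh g" := (hc2 f g) (at level 40, left associativity) : cell_scope.

Section TwoCategories.
Variables (K : fieldType) (B : tcat K).
Implicit Types A C D E : B.

(** The identities X(YZ) = (XY)Z, 1X = X and X1 = X as 2-cells; [assl], [l1i],
    [r1i] are the same identities read backwards. *)
Definition assr A C D E (X : hcat B D E) (Y : hcat B C D) (Z : hcat B A C) :
    X \h (Y \h Z) ~~> X \h Y \h Z := eq_hom (hcA X Y Z).
Definition assl A C D E (X : hcat B D E) (Y : hcat B C D) (Z : hcat B A C) :
    X \h Y \h Z ~~> X \h (Y \h Z) := eq_hom (esym (hcA X Y Z)).
Definition l1 A C (X : hcat B A C) : \I_C \h X ~~> X := eq_hom (hc1l X).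
Definition l1i A C (X : hcat B A C) : X ~~> \I_C \h X := eq_hom (esym (hc1l X)).
Definition r1 A C (X : hcat B A C) : X \h \I_A ~~> X := eq_hom (hcl1 X).
Definition r1i A C (X : hcat B A C) : X ~~> X \h \I_A := eq_hom (esym (hcl1 X)).

Record left_dual A C (X : hcat B A C) := LeftDual {
  ldual : hcat B C A;
  lev : X \h ldual ~~> \I_C;
  lcoev : \I_A ~~> ldual \h X;
  ldual_tri1 :
    l1 X \v (lev \hh \id_X) \v assr X ldual X \v (\id_X \hh lcoev) \v r1i X
    = \id_X;
  ldual_tri2 :
    r1 ldual \v (\id_ldual \hh lev) \v assl ldual X ldual
      \v (lcoev \hh \id_ldual) \v l1i ldual
    = \id_ldual
}.

Record right_dual A C (X : hcat B A C) := RightDual {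
  rdual : hcat B C A;
  rev : rdual \h X ~~> \I_A;
  rcoev : \I_C ~~> X \h rdual;
  rdual_tri1 :
    r1 X \v (\id_X \hh rev) \v assl X rdual X \v (rcoev \hh \id_X) \v l1i X
    = \id_X;
  rdual_tri2 :
    l1 rdual \v (rev \hh \id_rdual) \v assr rdual X rdual
      \v (\id_rdual \hh rcoev) \v r1i rdual
    = \id_rdual
}.

Definition is_rigid : Prop :=
  forall A C (X : hcat B A C), inhabited (left_dual X) /\ inhabited (right_dual X).

Record is_finite_tcat : Prop := IsFiniteTCat {
  ftcat_rigid : is_rigid;
  ftcat_abelian : forall A C, is_abelian (hcat B A C);
  ftcat_finite : forall A C, is_finite (hcat B A C);
  ftcat_simple : forall A, is_simple (\I_A : hcat B A A)
}.

(** The mate of [f : X ~~> Y], from an evaluation [Y \h Y' ~~> 1] to a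
    coevaluation [1 ~~> X' \h X]. *)
Definition mate A C (X Y : hcat B A C) (X' Y' : hcat B C A)
    (coev : \I_A ~~> X' \h X) (f : X ~~> Y) (ev : Y \h Y' ~~> \I_C) :
    Y' ~~> X' :=
  r1 X' \v (\id_X' \hh ev) \v (\id_X' \hh (f \hh \id_Y')) \v assl X' X Y'
    \v (coev \hh \id_Y') \v l1i Y'.

(** The coevaluation 1 -> X' X -> X' Y' Y X making X' Y' a left dual of Y X. *)
Definition coev_comp A C D (Y : hcat B A D) (X : hcat B C A)
    (Y' : hcat B D A) (X' : hcat B A C)
    (coevY : \I_A ~~> Y' \h Y) (coevX : \I_C ~~> X' \h X) :
    \I_C ~~> X' \h Y' \h (Y \h X) :=
  assr X' Y' (Y \h X) \v (\id_X' \hh assl Y' Y X)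
    \v (\id_X' \hh (coevY \hh \id_X)) \v (\id_X' \hh l1i X) \v coevX.

End TwoCategories.

Section ChosenDuals.
Variables (K : fieldType) (B : tcat K).
Variable ld : forall (A C : B) (X : hcat B A C), left_dual X.

Definition ldual_hom (A C : B) (X Y : hcat B A C) (f : X ~~> Y) :
    ldual (ld Y) ~~> ldual (ld X) :=
  mate (lcoev (ld X)) f (lev (ld Y)).

(** The comparison *(Y X) -> *X *Y of two left duals of Y X, as the mate of the
    identity. *)
Definition ldual_comp (A C D : B) (Y : hcat B A D) (X : hcat B C A) :
    ldual (ld (Y \h X)) ~~> ldual (ld X) \h ldual (ld Y) :=
  mate (coev_comp (lcoev (ld Y)) (lcoev (ld X))) \id_(Y \h X)
    (lev (ld (Y \h X))).

Definition is_dinatural (A C : B) (L : hcat B A A)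
    (p : forall X : hcat B A C, L ~~> ldual (ld X) \h X) : Prop :=
  forall (X Y : hcat B A C) (f : X ~~> Y),
    (\id_(ldual (ld X)) \hh f) \v p X = (ldual_hom f \hh \id_Y) \v p Y.

(** [L], with projections [p], is the end over X of the 1-cells X' X, where X'
    is the left dual of X. *)
Definition is_end (A C : B) (L : hcat B A A)
    (p : forall X : hcat B A C, L ~~> ldual (ld X) \h X) : Prop :=
  is_dinatural p /\
  forall (M : hcat B A A) (q : forall X : hcat B A C, M ~~> ldual (ld X) \h X),
    is_dinatural q -> exists! h : M ~~> L, forall X, p X \v h = q X.

End ChosenDuals.

Section EqHom.
Variables (K : fieldType) (C : kcat K).

Lemma eq_hom_id (X : C) (e : X = X) : eq_hom e = \id_X.
Proof. by rewrite (proof_irrelevance _ e erefl). Qed.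

Lemma eq_hom_irr (X Y : C) (e e' : X = Y) : eq_hom e = eq_hom e'.
Proof. by rewrite (proof_irrelevance _ e e'). Qed.

Lemma eq_hom_comp (X Y Z : C) (e : X = Y) (e' : Y = Z) :
  eq_hom e' \v eq_hom e = eq_hom (etrans e e').
Proof. by case: Z / e'; rewrite kcomp1l. Qed.

(** Equality of 2-cells whose sources and targets are equal 1-cells. *)
Definition heq (X Y X' Y' : C) (f : X ~~> Y) (g : X' ~~> Y') : Prop :=
  exists (e : X = X') (e' : Y = Y'), eq_hom e' \v f = g \v eq_hom e.

Lemma heq_eq (X Y : C) (f g : X ~~> Y) : heq f g -> f = g.
Proof. by case=> e [e']; rewrite !eq_hom_id kcomp1l kcompl1. Qed.

Lemma heq_refl (X Y : C) (f : X ~~> Y) : heq f f.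
Proof. by exists erefl, erefl; rewrite kcomp1l kcompl1. Qed.

Lemma heq_of_eq (X Y : C) (f g : X ~~> Y) : f = g -> heq f g.
Proof. by move=> ->; apply: heq_refl. Qed.

Lemma heq_sym (X Y X' Y' : C) (f : X ~~> Y) (g : X' ~~> Y') :
  heq f g -> heq g f.
Proof.
case=> e [e']; case: X' / e g; case: Y' / e' => g /=.
by rewrite kcomp1l kcompl1 => ->; apply: heq_refl.
Qed.

Lemma heq_trans (X Y X' Y' X'' Y'' : C) (g : X' ~~> Y') (f : X ~~> Y)
    (h : X'' ~~> Y'') : heq f g -> heq g h -> heq f h.
Proof.
case=> e [e']; case: X' / e g; case: Y' / e' => g /=.
by rewrite kcomp1l kcompl1 => ->.
Qed.

Lemma heq_comp (X Y Z X' Y' Z' : C) (g : Y ~~> Z) (f : X ~~> Y)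
    (g' : Y' ~~> Z') (f' : X' ~~> Y') :
  heq g g' -> heq f f' -> heq (g \v f) (g' \v f').
Proof.
case=> e [e']; case: Y' / e g' f'; case: Z' / e' => g' f' /=.
rewrite kcomp1l kcompl1 => ->; case=> e [e'].
case: X' / e f' => f'; rewrite eq_hom_id kcomp1l kcompl1 => ->.
exact: heq_refl.
Qed.

Lemma heq_eql (X Y Z X' Y' : C) (e : Y = Z) (f : X ~~> Y) (g : X' ~~> Y') :
  heq f g -> heq (eq_hom e \v f) g.
Proof. by case: Z / e; rewrite kcomp1l. Qed.

Lemma heq_eqr (X Y Z X' Y' : C) (e : X = Y) (f : Y ~~> Z) (g : X' ~~> Y') :
  heq f g -> heq (f \v eq_hom e) g.
Proof. by case: Y / e f => f; rewrite kcompl1. Qed.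

Lemma heq_eql' (X Y Z X' Y' : C) (e : Y = Z) (f : X ~~> Y) (g : X' ~~> Y') :
  heq g f -> heq g (eq_hom e \v f).
Proof. by move=> /heq_sym H; apply/heq_sym/heq_eql. Qed.

Lemma heq_eqr' (X Y Z X' Y' : C) (e : X = Y) (f : Y ~~> Z) (g : X' ~~> Y') :
  heq g f -> heq g (f \v eq_hom e).
Proof. by move=> /heq_sym H; apply/heq_sym/heq_eqr. Qed.

Lemma eq_homK (X Y : C) (e : X = Y) : eq_hom (esym e) \v eq_hom e = \id_X.
Proof. by case: Y / e; rewrite kcomp1l. Qed.

Lemma eq_homVK (X Y : C) (e : X = Y) : eq_hom e \v eq_hom (esym e) = \id_Y.
Proof. by case: Y / e; rewrite kcomp1l. Qed.

Lemma eq_hom_iso (X Y : C) (e : X = Y) : is_iso (eq_hom e).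
Proof. by exists (eq_hom (esym e)); rewrite eq_homK eq_homVK. Qed.

Lemma iso_comp (X Y Z : C) (g : Y ~~> Z) (f : X ~~> Y) :
  is_iso g -> is_iso f -> is_iso (g \v f).
Proof.
case=> g' [g1 g2] [f' [f1 f2]]; exists (f' \v g'); split.
- by rewrite kcompA -(kcompA f') g1 kcompl1 f1.
- by rewrite kcompA -(kcompA g) f2 kcompl1 g2.
Qed.

End EqHom.

Section EqHom2.
Variables (K : fieldType) (B : tcat K).
Implicit Types A C D E : B.

Lemma heq_h2 A C D (X Y X' Y' : hcat B C D) (Z T Z' T' : hcat B A C)
    (f : X ~~> Y) (f' : X' ~~> Y') (g : Z ~~> T) (g' : Z' ~~> T') :
  heq f f' -> heq g g' -> heq (f \hh g) (f' \hh g').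
Proof.
case=> e [e']; case: X' / e f'; case: Y' / e' => f' /=.
rewrite kcomp1l kcompl1 => ->.
case=> e [e']; case: Z' / e g'; case: T' / e' => g' /=.
by rewrite kcomp1l kcompl1 => ->; apply: heq_refl.
Qed.

Lemma heq_A A C D E (X X' : hcat B D E) (Y Y' : hcat B C D) (Z Z' : hcat B A C)
    (f : X ~~> X') (g : Y ~~> Y') (h : Z ~~> Z') :
  heq (f \hh (g \hh h)) (f \hh g \hh h).
Proof. by exists (hcA X Y Z), (hcA X' Y' Z'); apply: hc2A. Qed.

Lemma heq_1l A C (X X' : hcat B A C) (f : X ~~> X') : heq (\id_(\I_C) \hh f) f.
Proof. by exists (hc1l X), (hc1l X'); apply: hc21l. Qed.

Lemma heq_l1 A C (X X' : hcat B A C) (f : X ~~> X') : heq (f \hh \id_(\I_A)) f.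
Proof. by exists (hcl1 X), (hcl1 X'); apply: hc2l1. Qed.

Lemma id_h_comp A C D (X : hcat B C D) (Y Y' Y'' : hcat B A C)
    (g : Y' ~~> Y'') (f : Y ~~> Y') :
  \id_X \hh (g \v f) = (\id_X \hh g) \v (\id_X \hh f).
Proof. by rewrite -hc2_comp kcomp1l. Qed.

Lemma comp_h_id A C D (X : hcat B A C) (Y Y' Y'' : hcat B C D)
    (g : Y' ~~> Y'') (f : Y ~~> Y') :
  (g \v f) \hh \id_X = (g \hh \id_X) \v (f \hh \id_X).
Proof. by rewrite -hc2_comp kcomp1l. Qed.

Lemma iso_h2 A C D (X X' : hcat B C D) (Y Y' : hcat B A C)
    (f : X ~~> X') (g : Y ~~> Y') : is_iso f -> is_iso g -> is_iso (f \hh g).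
Proof.
case=> f' [f1 f2] [g' [g1 g2]]; exists (f' \hh g').
by rewrite -!hc2_comp f1 f2 g1 g2 !hc2_id.
Qed.

End EqHom2.

Record moncat := MonCat {
  mobj :> Type;
  mhom : mobj -> mobj -> Type;
  mid : forall X, mhom X X;
  mcomp : forall X Y Z, mhom Y Z -> mhom X Y -> mhom X Z;
  mcompA : forall X Y Z T (h : mhom Z T) (g : mhom Y Z) (f : mhom X Y),
    mcomp h (mcomp g f) = mcomp (mcomp h g) f;
  mcomp1l : forall X Y (f : mhom X Y), mcomp (mid Y) f = f;
  mcompl1 : forall X Y (f : mhom X Y), mcomp f (mid X) = f;
  mten : mobj -> mobj -> mobj;
  mtenh : forall X X' Y Y', mhom X X' -> mhom Y Y' ->
    mhom (mten X Y) (mten X' Y');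
  mtenh_id : forall X Y, mtenh (mid X) (mid Y) = mid (mten X Y);
  mtenh_comp : forall X X' X'' Y Y' Y'' (f' : mhom X' X'') (f : mhom X X')
      (g' : mhom Y' Y'') (g : mhom Y Y'),
    mtenh (mcomp f' f) (mcomp g' g) = mcomp (mtenh f' g') (mtenh f g);
  mone : mobj;
  massoc : forall X Y Z, mhom (mten (mten X Y) Z) (mten X (mten Y Z));
  mlunit : forall X, mhom (mten mone X) X;
  mrunit : forall X, mhom (mten X mone) X;
  massoc_iso : forall X Y Z, exists g,
    mcomp g (massoc X Y Z) = mid _ /\ mcomp (massoc X Y Z) g = mid _;
  mlunit_iso : forall X, exists g,
    mcomp g (mlunit X) = mid _ /\ mcomp (mlunit X) g = mid _;
  mrunit_iso : forall X, exists g,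
    mcomp g (mrunit X) = mid _ /\ mcomp (mrunit X) g = mid _;
  massoc_nat : forall X X' Y Y' Z Z'
      (f : mhom X X') (g : mhom Y Y') (h : mhom Z Z'),
    mcomp (massoc X' Y' Z') (mtenh (mtenh f g) h) =
    mcomp (mtenh f (mtenh g h)) (massoc X Y Z);
  mlunit_nat : forall X X' (f : mhom X X'),
    mcomp (mlunit X') (mtenh (mid mone) f) = mcomp f (mlunit X);
  mrunit_nat : forall X X' (f : mhom X X'),
    mcomp (mrunit X') (mtenh f (mid mone)) = mcomp f (mrunit X);
  mpentagon : forall X Y Z T,
    mcomp (massoc X Y (mten Z T)) (massoc (mten X Y) Z T) =
    mcomp (mtenh (mid X) (massoc Y Z T))
      (mcomp (massoc X (mten Y Z) T) (mtenh (massoc X Y Z) (mid T)));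
  mtriangle : forall X Y,
    mcomp (mtenh (mid X) (mlunit Y)) (massoc X mone Y) =
    mtenh (mrunit X) (mid Y)
}.

Arguments mhom {M} X Y : rename.
Arguments mid {M} X : rename.
Arguments mcomp {M X Y Z} g f : rename.
Arguments mten {M} X Y : rename.
Arguments mtenh {M X X' Y Y'} f g : rename.
Arguments mone {M} : rename.
Arguments massoc {M} X Y Z : rename.
Arguments mlunit {M} X : rename.
Arguments mrunit {M} X : rename.

Record is_algebra (M : moncat) (X : M) (m : mhom (mten X X) X)
    (u : mhom mone X) : Prop := IsAlgebra {
  algebra_assoc :
    mcomp m (mtenh m (mid X)) =
    mcomp m (mcomp (mtenh (mid X) m) (massoc X X X));
  algebra_unitl : mcomp m (mtenh u (mid X)) = mlunit X;
  algebra_unitr : mcomp m (mtenh (mid X) u) = mrunit X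
}.

Section Center.
Variables (K : fieldType) (B : tcat K).
Implicit Types A C D : B.

Record zobj := ZObj {
  zcell :> forall A, hcat B A A;
  zbr : forall A C (X : hcat B A C), zcell C \h X ~~> X \h zcell A;
  zbr_iso : forall A C (X : hcat B A C), is_iso (zbr X);
  zbr_nat : forall A C (X Y : hcat B A C) (f : X ~~> Y),
    zbr Y \v (\id_(zcell C) \hh f) = (f \hh \id_(zcell A)) \v zbr X;
  zbr_one : forall A, zbr \I_A = l1i (zcell A) \v r1 (zcell A);
  zbr_comp : forall A C D (X : hcat B C D) (Y : hcat B A C),
    zbr (X \h Y) =
    assr X Y (zcell A) \v (\id_X \hh zbr Y) \v assl X (zcell C) Y
      \v (zbr X \hh \id_Y) \v assr (zcell D) X Y
}.

Record zhom (V W : zobj) := ZHom {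
  zmor :> forall A, V A ~~> W A;
  zmor_br : forall A C (X : hcat B A C),
    (\id_X \hh zmor A) \v zbr V X = zbr W X \v (zmor C \hh \id_X)
}.

Lemma zhom_ext (V W : zobj) (f g : zhom V W) : (forall A, f A = g A) -> f = g.
Proof.
case: f g => [f Hf] [g Hg] /= E.
have Efg : f = g by apply: functional_extensionality_dep.
by case: g / Efg Hg {E} => Hg; rewrite (proof_irrelevance _ Hf Hg).
Qed.

Lemma id_h_eq_hom A C D (X : hcat B C D) (Y Y' : hcat B A C) (e : Y = Y') :
  \id_X \hh eq_hom e = eq_hom (f_equal (hc1 X) e).
Proof. by case: Y' / e; rewrite hc2_id. Qed.

Lemma eq_hom_h_id A C D (X X' : hcat B C D) (Y : hcat B A C) (e : X = X') :
  eq_hom e \hh \id_Y = eq_hom (f_equal (fun Z => hc1 Z Y) e).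
Proof. by case: X' / e; rewrite hc2_id. Qed.

Ltac eq_hom_tac :=
  rewrite /assr /assl /l1 /l1i /r1 /r1i
    ?comp_h_id ?id_h_comp ?eq_hom_h_id ?id_h_eq_hom ?eq_hom_comp;
  apply: eq_hom_irr.

Lemma assr_nat A C D E (X X' : hcat B D E) (Y Y' : hcat B C D)
    (Z Z' : hcat B A C) (f : X ~~> X') (g : Y ~~> Y') (h : Z ~~> Z') :
  assr X' Y' Z' \v (f \hh (g \hh h)) = f \hh g \hh h \v assr X Y Z.
Proof. exact: hc2A. Qed.

Lemma assl_nat A C D E (X X' : hcat B D E) (Y Y' : hcat B C D)
    (Z Z' : hcat B A C) (f : X ~~> X') (g : Y ~~> Y') (h : Z ~~> Z') :
  assl X' Y' Z' \v (f \hh g \hh h) = f \hh (g \hh h) \v assl X Y Z.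
Proof.
apply: heq_eq; apply/heq_eql/heq_eqr'/heq_sym; exact: heq_A.
Qed.

Lemma zbr_heq_comp (V : zobj) A C D (X : hcat B C D) (Y : hcat B A C) :
  heq (zbr V (X \h Y)) ((\id_X \hh zbr V Y) \v assl X (V C) Y
    \v (zbr V X \hh \id_Y)).
Proof.
by rewrite zbr_comp -!kcompA; apply/heq_eql; rewrite !kcompA; apply/heq_eqr/heq_refl.
Qed.

Section Tensor.
Variables V W : zobj.

Definition zten_cell A : hcat B A A := V A \h W A.

Definition zten_br A C (X : hcat B A C) :
    zten_cell C \h X ~~> X \h zten_cell A :=
  assl X (V A) (W A) \v (zbr V X \hh \id_(W A)) \v assr (V C) X (W A)
    \v (\id_(V C) \hh zbr W X) \v assl (V C) (W C) X.

Lemma zten_br_iso A C (X : hcat B A C) : is_iso (zten_br X).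
Proof.
have id_iso D (Y : hcat B D D) : is_iso \id_Y by apply: (eq_hom_iso erefl).
do 4?[apply: iso_comp]; try exact: eq_hom_iso.
- by apply: iso_h2; [apply: zbr_iso | apply: id_iso].
- by apply: iso_h2; [apply: id_iso | apply: zbr_iso].
Qed.

Lemma zten_br_nat A C (X Y : hcat B A C) (f : X ~~> Y) :
  zten_br Y \v (\id_(zten_cell C) \hh f) =
  (f \hh \id_(zten_cell A)) \v zten_br X.
Proof.
rewrite /zten_br /zten_cell -!hc2_id -!kcompA assl_nat.
rewrite !kcompA -(kcompA _ (_ \hh zbr W Y)) -id_h_comp zbr_nat id_h_comp.
rewrite !kcompA -(kcompA _ (assr _ _ _) (_ \hh (f \hh _))) assr_nat.
rewrite !kcompA -(kcompA _ (zbr V Y \hh _)) -comp_h_id zbr_nat comp_h_id.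
by rewrite !kcompA assl_nat.
Qed.

Lemma zten_br_one A :
  zten_br \I_A = l1i (zten_cell A) \v r1 (zten_cell A).
Proof. by rewrite /zten_br !zbr_one; eq_hom_tac. Qed.

Lemma zten_br_comp A C D (X : hcat B C D) (Y : hcat B A C) :
  zten_br (X \h Y) =
  assr X Y (zten_cell A) \v (\id_X \hh zten_br Y) \v assl X (zten_cell C) Y
    \v (zten_br X \hh \id_Y) \v assr (zten_cell D) X Y.
Proof.
have P1 : heq (zbr V (X \h Y) \hh \id_(W A))
    ((\id_X \hh (zbr V Y \hh \id_(W A))) \v (\id_X \hh assr (V C) Y (W A))
     \v assl X (V C) (Y \h W A) \v (zbr V X \hh \id_(Y \h W A))).
  apply: heq_trans (heq_h2 (zbr_heq_comp V X Y) (heq_refl _)) _.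
  rewrite !comp_h_id /assl /assr eq_hom_h_id id_h_eq_hom; apply: heq_comp.
    by apply/heq_eqr/heq_eqr'/heq_eqr'/heq_sym/heq_A.
  by rewrite -hc2_id; apply/heq_sym/heq_A.
have P2 : heq (\id_(V D) \hh zbr W (X \h Y))
    ((\id_(V D \h X) \hh zbr W Y) \v assl (V D \h X) (W C) Y
     \v (assr (V D) X (W C) \hh \id_Y) \v ((\id_(V D) \hh zbr W X) \hh \id_Y)).
  apply: heq_trans (heq_h2 (heq_refl _) (zbr_heq_comp W X Y)) _.
  rewrite !id_h_comp /assl /assr eq_hom_h_id id_h_eq_hom; apply: heq_comp.
    by apply/heq_eqr/heq_eqr'/heq_eqr'; rewrite -hc2_id; apply/heq_A.
  exact: heq_A.
have Q1 : heq (\id_X \hh zten_br Y)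
    ((\id_X \hh (zbr V Y \hh \id_(W A))) \v (\id_X \hh assr (V C) Y (W A))
     \v assl X (V C) (Y \h W A) \v (\id_(X \h V C) \hh zbr W Y)).
  rewrite /zten_br !id_h_comp /assl /assr !id_h_eq_hom; apply: heq_eqr.
  apply: heq_comp; last by rewrite -hc2_id; apply: heq_A.
  by apply/heq_eqr/heq_eql/heq_eqr'/heq_eqr'/heq_refl.
have Q2 : heq (zten_br X \hh \id_Y)
    ((zbr V X \hh \id_(W C \h Y)) \v assl (V D \h X) (W C) Y
     \v (assr (V D) X (W C) \hh \id_Y) \v ((\id_(V D) \hh zbr W X) \hh \id_Y)).
  rewrite /zten_br !comp_h_id /assl /assr !eq_hom_h_id; apply: heq_eqr.
  apply: heq_comp; last exact: heq_refl.
  apply/heq_eqr/heq_eql/heq_eqr'/heq_eqr'.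
  by rewrite -hc2_id; apply/heq_sym/heq_A.
apply: heq_eq; rewrite {1}/zten_br.
apply/heq_eqr/heq_eqr'; rewrite -!(kcompA (assr _ _ _) ) -!(kcompA (assl _ _ _)).
apply/heq_eql/heq_eql'.
rewrite -!kcompA; apply: heq_trans (heq_comp P1 (heq_eql _ P2)) _.
apply: heq_sym; apply: heq_trans (heq_comp Q1 (heq_eql _ Q2)) _.
rewrite -!kcompA; do 3![apply: heq_comp; first exact: heq_refl].
rewrite !kcompA; do 3![apply: heq_comp; last exact: heq_refl].
by apply: heq_of_eq; rewrite -!hc2_comp !kcomp1l !kcompl1.
Qed.

Definition zten : zobj := ZObj zten_br_iso zten_br_nat zten_br_one zten_br_comp.

End Tensor.

Definition zone_br A C (X : hcat B A C) : \I_C \h X ~~> X \h \I_A :=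
  r1i X \v l1 X.

Lemma zone_br_iso A C (X : hcat B A C) : is_iso (zone_br X).
Proof. by apply: iso_comp; apply: eq_hom_iso. Qed.

Lemma zone_br_nat A C (X Y : hcat B A C) (f : X ~~> Y) :
  zone_br Y \v (\id_(\I_C) \hh f) = (f \hh \id_(\I_A)) \v zone_br X.
Proof.
apply: heq_eq; rewrite /zone_br !eq_hom_comp; apply/heq_eql/heq_eqr'.
exact: heq_trans (heq_1l f) (heq_sym (heq_l1 f)).
Qed.

Lemma zone_br_one A : zone_br \I_A = l1i \I_A \v r1 \I_A.
Proof. by rewrite /zone_br; eq_hom_tac. Qed.

Lemma zone_br_comp A C D (X : hcat B C D) (Y : hcat B A C) :
  zone_br (X \h Y) =
  assr X Y \I_A \v (\id_X \hh zone_br Y) \v assl X \I_C Y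
    \v (zone_br X \hh \id_Y) \v assr \I_D X Y.
Proof. by rewrite /zone_br; eq_hom_tac. Qed.

Definition zone : zobj := ZObj zone_br_iso zone_br_nat zone_br_one zone_br_comp.

Lemma zid_br (V : zobj) A C (X : hcat B A C) :
  (\id_X \hh \id_(V A)) \v zbr V X = zbr V X \v (\id_(V C) \hh \id_X).
Proof. by rewrite !hc2_id kcomp1l kcompl1. Qed.

Definition zid (V : zobj) : zhom V V := ZHom (zid_br V).

Lemma zcomp_br (U V W : zobj) (g : zhom V W) (f : zhom U V)
    A C (X : hcat B A C) :
  (\id_X \hh (g A \v f A)) \v zbr U X = zbr W X \v ((g C \v f C) \hh \id_X).
Proof. by rewrite id_h_comp comp_h_id -kcompA zmor_br !kcompA zmor_br. Qed.

Definition zcomp (U V W : zobj) (g : zhom V W) (f : zhom U V) : zhom U W :=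
  ZHom (zcomp_br g f).

Lemma ztenh_br (V V' W W' : zobj) (f : zhom V V') (g : zhom W W')
    A C (X : hcat B A C) :
  (\id_X \hh (f A \hh g A)) \v zten_br V W X =
  zten_br V' W' X \v ((f C \hh g C) \hh \id_X).
Proof.
rewrite /zten_br !kcompA -assl_nat -!kcompA; congr (_ \v _); rewrite !kcompA.
rewrite -hc2_comp kcompl1 zmor_br -{1}(kcomp1l (g A)) hc2_comp.
rewrite -!kcompA; congr (_ \v _); rewrite !kcompA -assr_nat.
rewrite -!kcompA; congr (_ \v _); rewrite !kcompA.
rewrite -hc2_comp kcompl1 zmor_br -{1}(kcomp1l (f C)) hc2_comp.
by rewrite -!kcompA; congr (_ \v _); rewrite assl_nat.
Qed.

Definition ztenh (V V' W W' : zobj) (f : zhom V V') (g : zhom W W') :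
  zhom (zten V W) (zten V' W') :=
  @ZHom (zten V W) (zten V' W') (fun A => f A \hh g A) (ztenh_br f g).

Lemma zassoc_br (U V W : zobj) A C (X : hcat B A C) :
  (\id_X \hh assl (U A) (V A) (W A)) \v zten_br (zten U V) W X =
  zten_br U (zten V W) X \v (assl (U C) (V C) (W C) \hh \id_X).
Proof.
apply: heq_eq; rewrite /zten_br /= /zten_br /zten_cell !comp_h_id !id_h_comp.
rewrite /assl /assr ?id_h_eq_hom ?eq_hom_h_id ?id_h_eq_hom !kcompA.
apply/heq_eqr/heq_eqr'/heq_eqr'/heq_eqr'; apply: heq_comp; last first.
  by rewrite -hc2_id; apply/heq_sym/heq_A.
apply/heq_eqr/heq_eqr/heq_eqr'; apply: heq_comp; last first.
  exact/heq_sym/heq_A.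
apply/heq_eqr/heq_eqr'/heq_eqr'; rewrite !eq_hom_comp.
by apply/heq_eql/heq_eql'; rewrite -hc2_id; apply/heq_sym/heq_A.
Qed.

Definition zassoc (U V W : zobj) :
    zhom (zten (zten U V) W) (zten U (zten V W)) :=
  @ZHom (zten (zten U V) W) (zten U (zten V W))
    (fun A => assl (U A) (V A) (W A)) (zassoc_br U V W).

Lemma zlunit_br (V : zobj) A C (X : hcat B A C) :
  (\id_X \hh l1 (V A)) \v zten_br zone V X = zbr V X \v (l1 (V C) \hh \id_X).
Proof.
apply: heq_eq.
rewrite /zten_br /= /zone_br comp_h_id.
rewrite /l1 /assl /assr /r1i ?id_h_eq_hom ?eq_hom_h_id -!kcompA.
do 5!apply/heq_eql; apply/heq_eqr/heq_eqr'.
exact: heq_1l.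
Qed.

Lemma zrunit_br (V : zobj) A C (X : hcat B A C) :
  (\id_X \hh r1 (V A)) \v zten_br V zone X = zbr V X \v (r1 (V C) \hh \id_X).
Proof.
apply: heq_eq.
rewrite /zten_br /= /zone_br id_h_comp.
rewrite /r1 /assl /assr /r1i /l1 ?id_h_eq_hom ?eq_hom_h_id !kcompA.
do 4!apply/heq_eqr; apply/heq_eqr'.
by rewrite -kcompA; apply/heq_eql/heq_eql/heq_l1.
Qed.

Definition zlunit (V : zobj) : zhom (zten zone V) V :=
  @ZHom (zten zone V) V (fun A => l1 (V A)) (zlunit_br V).
Definition zrunit (V : zobj) : zhom (zten V zone) V :=
  @ZHom (zten V zone) V (fun A => r1 (V A)) (zrunit_br V).

Lemma ziso (V W : zobj) (f : zhom V W) :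
  (forall A, is_iso (f A)) ->
  exists g : zhom W V, zcomp g f = zid V /\ zcomp f g = zid W.
Proof.
move=> iso_f.
pose g A := proj1_sig (constructive_indefinite_description _ (iso_f A)).
have gf A : g A \v f A = \id_(V A).
  by rewrite /g; case: constructive_indefinite_description => ? [].
have fg A : f A \v g A = \id_(W A).
  by rewrite /g; case: constructive_indefinite_description => ? [].
have g_br A C (X : hcat B A C) :
    (\id_X \hh g A) \v zbr W X = zbr V X \v (g C \hh \id_X).
  rewrite -[zbr W X]kcompl1 -hc2_id -(fg C) comp_h_id !kcompA.
  rewrite -(kcompA _ (zbr W X)) -zmor_br !kcompA -id_h_comp gf hc2_id.
  by rewrite kcomp1l.
by exists (ZHom g_br); split; apply: zhom_ext => A /=.
Qed.

Definition center : moncat.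
Proof.
refine (@MonCat zobj zhom zid zcomp _ _ _ zten ztenh _ _ zone zassoc zlunit
  zrunit _ _ _ _ _ _ _ _).
- by move=> *; apply: zhom_ext => A /=; apply: kcompA.
- by move=> *; apply: zhom_ext => A /=; apply: kcomp1l.
- by move=> *; apply: zhom_ext => A /=; apply: kcompl1.
- by move=> *; apply: zhom_ext => A /=; apply: hc2_id.
- by move=> *; apply: zhom_ext => A /=; apply: hc2_comp.
- by move=> *; apply: ziso => A; apply: eq_hom_iso.
- by move=> *; apply: ziso => A; apply: eq_hom_iso.
- by move=> *; apply: ziso => A; apply: eq_hom_iso.
- by move=> *; apply: zhom_ext => A /=; apply: assl_nat.
- by move=> *; apply: zhom_ext => A /=; apply: hc21l.
- by move=> *; apply: zhom_ext => A /=; apply: hc2l1.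
- by move=> *; apply: zhom_ext => A /=; eq_hom_tac.
- by move=> *; apply: zhom_ext => A /=; eq_hom_tac.
Defined.

End Center.

Section AdjointObject.
Variables (K : fieldType) (B : tcat K).
Variable ld : forall (A C : B) (X : hcat B A C), left_dual X.
Variable b : B.

(** The object Ad_b of the center, on the ends L(A, b). Modulo strictness,
    [ad_br] says that (p_Y o 1_X) = (ev_X o 1) (1_X o p_(Y X)) sigma_X, where p
    is [ad_proj] and *(Y X) is compared with *X *Y. *)
Record adjoint_object := AdjointObject {
  ad_obj :> zobj B;
  ad_proj : forall A (X : hcat B A b), ad_obj A ~~> ldual (ld X) \h X;
  ad_end : forall A, is_end (ad_proj (A := A));
  ad_br : forall A C (X : hcat B C A) (Y : hcat B A b),
    let X' := ldual (ld X) in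
    let Y' := ldual (ld Y) in
    ad_proj Y \hh \id_X =
    l1 (Y' \h Y \h X)
      \v (lev (ld X) \hh \id_(Y' \h Y \h X))
      \v (\id_(X \h X') \hh assr Y' Y X)
      \v assr X X' (Y' \h (Y \h X))
      \v (\id_X \hh assl X' Y' (Y \h X))
      \v (\id_X \hh (ldual_comp ld Y X \hh \id_(Y \h X)))
      \v (\id_X \hh ad_proj (Y \h X))
      \v zbr ad_obj X
}.

Definition is_ad_mult (Ad : adjoint_object) A (m : Ad A \h Ad A ~~> Ad A) : Prop :=
  forall X : hcat B A b,
    let X' := ldual (ld X) in
    ad_proj Ad X \v m =
    (\id_X' \hh l1 X)
      \v (\id_X' \hh (lev (ld X) \hh \id_X))
      \v (\id_X' \hh assr X X' X)
      \v assl X' X (X' \h X)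
      \v (ad_proj Ad X \hh ad_proj Ad X).

Definition is_ad_unit (Ad : adjoint_object) A (u : \I_A ~~> Ad A) : Prop :=
  forall X : hcat B A b, ad_proj Ad X \v u = lcoev (ld X).

End AdjointObject.

(* Main.v *)
Require Import Defs.
From mathcomp Require Import all_boot all_algebra.
From Stdlib Require Import IndefiniteDescription.

(** A 2-cell with source X_1 ... X_n is studied through its action on right-nested
    1-cells X_1 (X_2 (... (X_n Z))), naturally in Z; in this form no associator
    or unit 2-cell occurs, and nothing is lost since one can take Z = 1.
    The cones X |-> (X' ev_X X)(p_X p_X) and X |-> coev_X are dinatural, hence
    induce m and u, and the algebra axioms follow from the triangle identities
    after composition with the p_X. That m and u commute with the half-braiding
    sigma_X is checked after composition with sigma_X^-1 and then with the p_Y X,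
    which are jointly monic because (- X) has a left adjoint (- X'); by the
    characterization of sigma_X the composite (p_Y X) sigma_X^-1 is expressed by
    ev_X and p_(YX), so the two sides agree once ev_(YX) and coev_(YX) are
    written in terms of X and Y. *)

Set Implicit Arguments.
Unset Strict Implicit.
Unset Printing Implicit Defensive.

Local Open Scope cell_scope.

(** * Identity 2-cells between equal 1-cells, whiskering and interchange *)

Section Coherence.
Variable K : fieldType.

Lemma heq_eq_hom (C : kcat K) (X Y X' Y' : C) (e : X = Y) (e' : X' = Y') :
  X = X' -> heq (eq_hom e) (eq_hom e').
Proof.
move=> E; case: X' / E e' => e'; case: Y / e; case: Y' / e'; exact: heq_refl.
Qed.

Lemma eq_hom_comp_l (C : kcat K) (W X Y Z : C) (e : X = Y) (e' : Y = Z)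
    (f : W ~~> X) :
  eq_hom e' \v (eq_hom e \v f) = eq_hom (etrans e e') \v f.
Proof. by rewrite kcompA eq_hom_comp. Qed.

(** Carries a known equation [f' = g'] over to a differently bracketed form; the triangle identities
    and the defining equation of the half-braiding are restated as actions on 1-cells in this
    way. *)
Lemma eq_hom_conj (C : kcat K) (X Y X' Y' : C) (f g : X ~~> Y)
    (f' g' : X' ~~> Y') : heq f' f -> f' = g' -> heq g' g -> f = g.
Proof.
by move=> h1 e h2; apply: heq_eq; rewrite e in h1; apply: heq_trans (heq_sym h1) h2.
Qed.

Variable B : tcat K.

Lemma whiskerr_faithful (A C : B) (X Y : hcat B A C) (f g : X ~~> Y) :
  (forall D (Z : hcat B D A), f \hh \id_Z = g \hh \id_Z) -> f = g.
Proof.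
move=> /(_ _ \I_A) e; apply: heq_eq.
by apply: heq_trans (heq_sym (heq_l1 f)) _; rewrite e; apply: heq_l1.
Qed.

Lemma hc2_split (A C D : B) (X X' : hcat B C D) (Y Y' : hcat B A C)
    (f : X ~~> X') (g : Y ~~> Y') :
  f \hh g = (f \hh \id_Y') \v (\id_X \hh g).
Proof. by rewrite -hc2_comp kcomp1l kcompl1. Qed.

Lemma hc2_swap (A C D : B) (X X' : hcat B C D) (Y Y' : hcat B A C)
    (f : X ~~> X') (g : Y ~~> Y') :
  (f \hh \id_Y') \v (\id_X \hh g) = (\id_X' \hh g) \v (f \hh \id_Y).
Proof. by rewrite -!hc2_comp !kcomp1l !kcompl1. Qed.

Lemma assrK (A C D E : B) (X : hcat B D E) (Y : hcat B C D) (Z : hcat B A C) :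
  assl X Y Z \v assr X Y Z = \id_(X \h (Y \h Z)).
Proof. exact: eq_homK. Qed.

Lemma asslK (A C D E : B) (X : hcat B D E) (Y : hcat B C D) (Z : hcat B A C) :
  assr X Y Z \v assl X Y Z = \id_(X \h Y \h Z).
Proof. exact: eq_homVK. Qed.

Lemma r1_nat (A C : B) (X Y : hcat B A C) (g : X ~~> Y) :
  r1 Y \v (g \hh \id_(\I_A)) = g \v r1 X.
Proof. exact: hc2l1. Qed.

Lemma l1i_nat (A C : B) (X Y : hcat B A C) (g : X ~~> Y) :
  l1i Y \v g = (\id_(\I_C) \hh g) \v l1i X.
Proof.
apply: heq_eq; apply: heq_eql; apply: heq_eqr'; apply: heq_sym; exact: heq_1l.
Qed.

End Coherence.

(** * Comparison of composites modulo associators and units *)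

Ltac heq_layer :=
  first
  [ exact: heq_refl
  | match goal with
    | |- heq ((_ \hh _) \hh _) _ =>
        apply: (heq_trans (heq_sym (heq_A _ _ _)))
    | |- heq _ ((_ \hh _) \hh _) =>
        refine (heq_trans _ (heq_A _ _ _))
    | |- heq (_ \hh _) (_ \hh _) => apply: heq_h2
    end; heq_layer ].

(** Drops identity 2-cells and matches the remaining factors in order; identities of composite
    1-cells are split by [hc2_id] so that [heq_layer] can rebracket them to the right. *)
Ltac heq_layers :=
  match goal with
  | |- heq (eq_hom _) (eq_hom _) => apply: heq_eq_hom; reflexivity
  | |- heq (eq_hom _ \v _) _ => apply: heq_eql; heq_layers
  | |- heq _ (eq_hom _ \v _) => apply: heq_eql'; heq_layers
  | |- heq (_ \v eq_hom _) _ => apply: heq_eqr; heq_layers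
  | |- heq _ (_ \v eq_hom _) => apply: heq_eqr'; heq_layers
  | |- heq (_ \v _) (_ \v _) =>
      apply: heq_comp; [rewrite -?hc2_id; heq_layer | heq_layers]
  | |- heq _ _ => rewrite -?hc2_id; heq_layer
  end.

(* Proves [heq] of composites that differ only by the placing of identity
   2-cells between equal 1-cells. *)
Ltac coh :=
  rewrite /assr /assl /l1 /l1i /r1 /r1i;
  repeat rewrite ?comp_h_id ?id_h_comp ?eq_hom_h_id ?id_h_eq_hom;
  rewrite -?kcompA; rewrite ?eq_hom_comp_l ?eq_hom_comp;
  heq_layers.

(** * Evaluation and coevaluation as natural actions *)

Section Action.
Variables (K : fieldType) (B : tcat K).

Section Duality.
Variables (A C : B) (X : hcat B A C) (dX : left_dual X).
Let X' := ldual dX.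

(* [locked], here and below, because [rewrite] would otherwise see through the
   definition when matching composites. *)
Definition ev_at D (Z : hcat B D C) : X \h (X' \h Z) ~~> Z :=
  locked (l1 Z \v (lev dX \hh \id_Z) \v assr X X' Z).

Definition coev_at D (Z : hcat B D A) : Z ~~> X' \h (X \h Z) :=
  locked (assl X' X Z \v (lcoev dX \hh \id_Z) \v l1i Z).

Lemma ev_atE D (Z : hcat B D C) :
  ev_at Z = l1 Z \v (lev dX \hh \id_Z) \v assr X X' Z.
Proof. by rewrite /ev_at -lock. Qed.

Lemma coev_atE D (Z : hcat B D A) :
  coev_at Z = assl X' X Z \v (lcoev dX \hh \id_Z) \v l1i Z.
Proof. by rewrite /coev_at -lock. Qed.

Lemma ev_at_nat D (Z Z' : hcat B D C) (g : Z ~~> Z') :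
  ev_at Z' \v (\id_X \hh (\id_X' \hh g)) = g \v ev_at Z.
Proof.
rewrite !ev_atE -!kcompA assr_nat hc2_id !kcompA; congr (_ \v _).
by rewrite -kcompA hc2_swap kcompA hc21l.
Qed.

Lemma coev_at_nat D (Z Z' : hcat B D A) (g : Z ~~> Z') :
  coev_at Z' \v g = (\id_X' \hh (\id_X \hh g)) \v coev_at Z.
Proof.
rewrite !coev_atE !kcompA -assl_nat -kcompA l1i_nat !kcompA; congr (_ \v _).
by rewrite -!kcompA hc2_swap hc2_id.
Qed.

Lemma ev_coev_at D (Z : hcat B D A) :
  ev_at (X \h Z) \v (\id_X \hh coev_at Z) = \id_(X \h Z).
Proof.
rewrite ev_atE coev_atE /X'.
(* The first triangle identity, whiskered with [Z], is the claim up to identity 2-cells. *)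
apply: (eq_hom_conj _ (congr1 (fun f => f \hh \id_Z) (ldual_tri1 dX)) _).
  coh.
by rewrite hc2_id; apply: heq_refl.
Qed.

Lemma coev_ev_at D (Z : hcat B D C) :
  (\id_X' \hh ev_at Z) \v coev_at (X' \h Z) = \id_(X' \h Z).
Proof.
rewrite ev_atE coev_atE /X'.
apply: (eq_hom_conj _ (congr1 (fun f => f \hh \id_Z) (ldual_tri2 dX)) _).
  coh.
by rewrite hc2_id; apply: heq_refl.
Qed.

End Duality.
End Action.

(** * Mates, and dinaturality of evaluation and coevaluation *)

Section Mates.
Variables (K : fieldType) (B : tcat K).

Section Mate.
Variables (A C : B) (X Y : hcat B A C) (dX : left_dual X) (dY : left_dual Y).
Variable f : X ~~> Y.
Let X' := ldual dX.
Let Y' := ldual dY.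
Let f' : Y' ~~> X' := mate (lcoev dX) f (lev dY).

Lemma mate_at D (Z : hcat B D C) :
  f' \hh \id_Z =
  (\id_X' \hh ev_at dY Z) \v (\id_X' \hh (f \hh \id_(Y' \h Z)))
    \v coev_at dX (Y' \h Z).
Proof. by apply: heq_eq; rewrite /f' /mate !ev_atE !coev_atE /X' /Y'; coh. Qed.

(** By naturality the evaluation of [X] slides through the formula for [f'] until it meets the
    coevaluation of [X], and a triangle identity removes both. *)
Lemma ev_at_mate D (Z : hcat B D C) :
  ev_at dX Z \v (\id_X \hh (f' \hh \id_Z)) =
  ev_at dY Z \v (f \hh \id_(Y' \h Z)).
Proof.
rewrite mate_at !id_h_comp !kcompA ev_at_nat -(kcompA _ (ev_at dX _)) ev_at_nat.
by rewrite -!kcompA ev_coev_at kcompl1.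
Qed.

(** The same cancellation, now with the triangle identity of [Y]; this dinaturality yields the cone
    that induces the unit. *)
Lemma mate_coev_at D (Z : hcat B D A) :
  (f' \hh \id_(Y \h Z)) \v coev_at dY Z =
  (\id_X' \hh (f \hh \id_Z)) \v coev_at dX Z.
Proof.
rewrite mate_at -!kcompA coev_at_nat !kcompA -!id_h_comp -!kcompA.
rewrite (hc2_swap f) kcompA.
by rewrite ev_coev_at kcomp1l.
Qed.

End Mate.
End Mates.

(** * The dual of a composite 1-cell *)

Section CompositeDual.
Variables (K : fieldType) (B : tcat K).
Variable ld : forall (A C : B) (X : hcat B A C), left_dual X.
Variables (A C D : B) (Y : hcat B A D) (X : hcat B C A).
Let W := Y \h X.
Let X' := ldual (ld X).
Let Y' := ldual (ld Y).
Let W' := ldual (ld W).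

Definition ldual_comp_at E (Z : hcat B E D) : W' \h Z ~~> X' \h (Y' \h Z) :=
  locked (assl X' Y' Z \v (ldual_comp ld Y X \hh \id_Z)).

Lemma ldual_comp_atD E (Z : hcat B E D) :
  ldual_comp_at Z = assl X' Y' Z \v (ldual_comp ld Y X \hh \id_Z).
Proof. by rewrite /ldual_comp_at -lock. Qed.

Lemma ldual_comp_at_nat E (Z Z' : hcat B E D) (g : Z ~~> Z') :
  ldual_comp_at Z' \v (\id_W' \hh g) =
  (\id_X' \hh (\id_Y' \hh g)) \v ldual_comp_at Z.
Proof.
rewrite !ldual_comp_atD !kcompA -assl_nat -!kcompA; congr (_ \v _).
by rewrite hc2_swap hc2_id.
Qed.

Lemma ldual_comp_atE E (Z : hcat B E D) :
  ldual_comp_at Z =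
  (\id_X' \hh (\id_Y' \hh (ev_at (ld W) Z \v assr Y X (W' \h Z))))
    \v (\id_X' \hh coev_at (ld Y) (X \h (W' \h Z)))
    \v coev_at (ld X) (W' \h Z).
Proof.
apply: heq_eq.
rewrite ldual_comp_atD /ldual_comp /mate /coev_comp !ev_atE !coev_atE.
rewrite !hc2_id !kcompl1 /W /X' /Y' /W'; coh.
Qed.


(** The two coevaluations in [ldual_comp_atE] cancel against the evaluations of [X] and [Y], leaving
    the evaluation of [W]. *)
Lemma ev_ldual_comp_at E (Z : hcat B E D) :
  ev_at (ld Y) Z \v (\id_Y \hh ev_at (ld X) (Y' \h Z))
    \v (\id_Y \hh (\id_X \hh ldual_comp_at Z)) =
  ev_at (ld W) Z \v assr Y X (W' \h Z).
Proof.
have -> : ev_at (ld Y) Z \v (\id_Y \hh ev_at (ld X) (Y' \h Z))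
    \v (\id_Y \hh (\id_X \hh ldual_comp_at Z)) =
    ev_at (ld Y) Z \v (\id_Y \hh ((\id_Y' \hh (ev_at (ld W) Z \v assr Y X (W' \h Z)))
     \v coev_at (ld Y) (X \h (W' \h Z)))).
  rewrite -kcompA -id_h_comp ldual_comp_atE !(id_h_comp X) !kcompA ev_at_nat.
  by rewrite -(kcompA _ (ev_at (ld X) _)) ev_at_nat -!kcompA ev_coev_at kcompl1.
by rewrite (id_h_comp Y) kcompA ev_at_nat -!kcompA ev_coev_at kcompl1.
Qed.

(** The evaluation of [W] in [ldual_comp_atE] cancels against its coevaluation, leaving the
    coevaluations of [X] and [Y]. *)
Lemma ldual_comp_coev_at E (Z : hcat B E C) :
  ldual_comp_at (Y \h (X \h Z)) \v (\id_W' \hh assl Y X Z) \v coev_at (ld W) Z =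
  (\id_X' \hh coev_at (ld Y) (X \h Z)) \v coev_at (ld X) Z.
Proof.
have assrW (g : Z ~~> W' \h (Y \h (X \h Z))) :
    assr Y X _ \v (\id_Y \hh (\id_X \hh g)) = (\id_W \hh g) \v assr Y X Z.
  by rewrite assr_nat hc2_id.
rewrite ldual_comp_atE -!kcompA !coev_at_nat.
rewrite (kcompA _ (\id_X' \hh _) (coev_at _ _)) -(id_h_comp X') coev_at_nat.
rewrite !kcompA -!(id_h_comp X') !kcompA -!(id_h_comp Y').
rewrite -(kcompA (ev_at _ _)) assrW.
rewrite (id_h_comp W) !kcompA ev_at_nat -(kcompA (assl _ _ _)) ev_coev_at.
by rewrite kcompl1 assrK hc2_id kcomp1l.
Qed.

End CompositeDual.

(** * Half-braidings acting on 1-cells *)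

Section CenterAction.
Variables (K : fieldType) (B : tcat K).

Definition br_at (V : zobj B) (A C D : B) (X : hcat B C A) (Z : hcat B D C) :
    V A \h (X \h Z) ~~> X \h (V C \h Z) :=
  locked (assl X (V C) Z \v (zbr V X \hh \id_Z) \v assr (V A) X Z).

Lemma br_atE (V : zobj B) (A C D : B) (X : hcat B C A) (Z : hcat B D C) :
  br_at V X Z = assl X (V C) Z \v (zbr V X \hh \id_Z) \v assr (V A) X Z.
Proof. by rewrite /br_at -lock. Qed.

Lemma br_at_nat (V : zobj B) (A C D : B) (X : hcat B C A) (Z Z' : hcat B D C)
    (g : Z ~~> Z') :
  br_at V X Z' \v (\id_(V A) \hh (\id_X \hh g)) =
  (\id_X \hh (\id_(V C) \hh g)) \v br_at V X Z.
Proof.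
rewrite !br_atE -!kcompA assr_nat !kcompA -assl_nat -!kcompA; congr (_ \v _).
by rewrite !kcompA; congr (_ \v _); rewrite !hc2_id hc2_swap.
Qed.

Lemma br_at_ten (V W : zobj B) (A C D : B) (X : hcat B C A) (Z : hcat B D C) :
  (zten_br V W X \hh \id_Z) =
  assr X (V C \h W C) Z \v (\id_X \hh assr (V C) (W C) Z) \v br_at V X (W C \h Z)
    \v (\id_(V A) \hh br_at W X Z)
    \v assl (V A) (W A) (X \h Z) \v assl (V A \h W A) X Z.
Proof. by apply: heq_eq; rewrite !br_atE /zten_br /zten_cell; coh. Qed.

End CenterAction.

(** * Cones over the 1-cells X' X and their dinaturality *)

Section Adjoint.
Variables (K : fieldType) (B : tcat K).
Variable ld : forall (A C : B) (X : hcat B A C), left_dual X.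
Variable b : B.
Local Notation "X ^*" := (ldual (ld X)) : cell_scope.

Section Cone.
Variables (A : B) (M : hcat B A A).

Definition cone_at (X : hcat B A b) (q : M ~~> X^* \h X) D (Z : hcat B D A) :
    M \h Z ~~> X^* \h (X \h Z) :=
  locked (assl X^* X Z \v (q \hh \id_Z)).

Lemma cone_atE (X : hcat B A b) (q : M ~~> X^* \h X) D (Z : hcat B D A) :
  cone_at q Z = assl X^* X Z \v (q \hh \id_Z).
Proof. by rewrite /cone_at -lock. Qed.

Lemma cone_at_nat (X : hcat B A b) (q : M ~~> X^* \h X)
    D (Z Z' : hcat B D A) (g : Z ~~> Z') :
  cone_at q Z' \v (\id_M \hh g) =
  (\id_X^* \hh (\id_X \hh g)) \v cone_at q Z.
Proof.
by rewrite !cone_atE !kcompA -assl_nat -!kcompA hc2_swap hc2_id.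
Qed.

(** Each side is an associator after one side of the dinaturality equation whiskered with [Z]; both
    the associator and the whiskering can be cancelled. *)
Lemma is_dinatural_at (q : forall X : hcat B A b, M ~~> X^* \h X) :
  is_dinatural q <->
  forall (X Y : hcat B A b) (f : X ~~> Y) D (Z : hcat B D A),
    (\id_X^* \hh (f \hh \id_Z)) \v cone_at (q X) Z =
    (ldual_hom ld f \hh \id_(Y \h Z)) \v cone_at (q Y) Z.
Proof.
have E X Y (f : X ~~> Y) D (Z : hcat B D A) :
    (\id_X^* \hh (f \hh \id_Z)) \v cone_at (q X) Z =
    assl _ _ _ \v (((\id_X^* \hh f) \v q X) \hh \id_Z).
  by rewrite cone_atE kcompA -assl_nat comp_h_id kcompA.
have E' X Y (f : X ~~> Y) D (Z : hcat B D A) :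
    (ldual_hom ld f \hh \id_(Y \h Z)) \v cone_at (q Y) Z =
    assl _ _ _ \v (((ldual_hom ld f \hh \id_Y) \v q Y) \hh \id_Z).
  by rewrite cone_atE kcompA -hc2_id -assl_nat comp_h_id kcompA.
split=> dq X Y f; first by move=> D Z; rewrite E E' dq.
apply: whiskerr_faithful => D Z.
have := dq X Y f D Z; rewrite E E' => /(congr1 (fun g => assr _ _ _ \v g)).
by rewrite !kcompA asslK !kcomp1l.
Qed.

End Cone.

Lemma is_dinatural_coev A :
  is_dinatural (L := \I_A) (fun X : hcat B A b => lcoev (ld X)).
Proof.
apply/is_dinatural_at => X Y f D Z.
have E (T : hcat B A b) : cone_at (lcoev (ld T)) Z = coev_at (ld T) Z \v l1 Z.
  by apply: heq_eq; rewrite cone_atE coev_atE; coh.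
by rewrite !E !kcompA mate_coev_at.
Qed.

(** * Joint monicity of the projections of the end *)

Variable Ad : adjoint_object ld b.
Local Notation p := (ad_proj Ad).

Lemma ad_dinatural_at A (X Y : hcat B A b) (f : X ~~> Y) D (Z : hcat B D A) :
  (\id_X^* \hh (f \hh \id_Z)) \v cone_at (p X) Z =
  (ldual_hom ld f \hh \id_(Y \h Z)) \v cone_at (p Y) Z.
Proof. by have [/is_dinatural_at dp _] := ad_end Ad A; apply: dp. Qed.

(** The composites of the [p X] with [g] form a dinatural cone, which factors through the end in
    only one way. *)
Lemma ad_proj_jointly_mono A (M : hcat B A A) (g h : M ~~> Ad A) :
  (forall X, p X \v g = p X \v h) -> g = h.
Proof.
move=> e; have [dp univ] := ad_end Ad A.
have [|k [_ uk]] := univ M (fun X => p X \v g).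
  by move=> X Y f; rewrite !kcompA dp.
by rewrite -(uk g) // (uk h).
Qed.

Lemma ad_proj_whiskerr_jointly_mono A C (X : hcat B C A) (M : hcat B C A)
    (g h : M ~~> Ad A \h X) :
  (forall Y, (p Y \hh \id_X) \v g = (p Y \hh \id_X) \v h) -> g = h.
Proof.
move=> e.
(* [tr k] is the transpose of [k] under the adjunction given by the left dual of [X]. *)
pose tr (k : M ~~> Ad A \h X) : M \h X^* ~~> Ad A :=
  r1 (Ad A) \v (\id_(Ad A) \hh lev (ld X)) \v assl (Ad A) X X^* \v (k \hh \id_X^*).
pose at_ (k : M ~~> Ad A \h X) D (Z : hcat B D C) : M \h Z ~~> Ad A \h (X \h Z) :=
  assl (Ad A) X Z \v (k \hh \id_Z).
have tr_at k D (Z : hcat B D A) :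
    tr k \hh \id_Z =
    (\id_(Ad A) \hh ev_at (ld X) Z) \v at_ k D (X^* \h Z) \v assl M X^* Z.
  by apply: heq_eq; rewrite /tr /at_ ev_atE; coh.
have at_nat k D (Z Z' : hcat B D C) (f : Z ~~> Z') :
    at_ k D Z' \v (\id_M \hh f) =
    (\id_(Ad A) \hh (\id_X \hh f)) \v at_ k D Z.
  by rewrite /at_ !kcompA -assl_nat -!kcompA hc2_swap hc2_id.
(* The transpose determines [k]: the coevaluation of [X] undoes the evaluation. *)
have at_tr k D (Z : hcat B D C) :
    at_ k D Z = (tr k \hh \id_(X \h Z)) \v assr M X^* (X \h Z)
      \v (\id_M \hh coev_at (ld X) Z).
  rewrite tr_at -(kcompA _ (assl _ _ _)) assrK kcompl1 -kcompA at_nat kcompA.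
  by rewrite -id_h_comp ev_coev_at hc2_id kcomp1l.
(* After [p Y], the transpose depends on [k] only through the composite that the hypothesis
   controls. *)
have p_tr k Y : p Y \v tr k =
    r1 (Y^* \h Y) \v (\id_(Y^* \h Y) \hh lev (ld X)) \v assl (Y^* \h Y) X X^*
      \v (((p Y \hh \id_X) \v k) \hh \id_X^*).
  rewrite /tr !kcompA -r1_nat -(kcompA (r1 _)) hc2_swap.
  rewrite comp_h_id !kcompA -(kcompA _ (assl _ _ _) (_ \hh _ \hh _)) assl_nat.
  by rewrite hc2_id !kcompA.
have e_tr : tr g = tr h.
  by apply: ad_proj_jointly_mono => Y; rewrite !p_tr e.
apply: whiskerr_faithful => D Z.
have : at_ g D Z = at_ h D Z by rewrite !at_tr e_tr.
move/(congr1 (fun k => assr (Ad A) X Z \v k)).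
by rewrite /at_ !kcompA asslK !kcomp1l.
Qed.

(** * The cone inducing the product; existence and uniqueness of product and unit *)

Section Multiplication.
Variable A : B.
Local Notation L := (Ad A).

Definition ad_mult_cone (X : hcat B A b) : L \h L ~~> X^* \h X :=
  (\id_X^* \hh l1 X)
    \v (\id_X^* \hh (lev (ld X) \hh \id_X))
    \v (\id_X^* \hh assr X X^* X)
    \v assl X^* X (X^* \h X)
    \v (p X \hh p X).

Lemma ad_mult_cone_at (X : hcat B A b) D (Z : hcat B D A) :
  cone_at (ad_mult_cone X) Z =
  (\id_X^* \hh ev_at (ld X) (X \h Z)) \v cone_at (p X) (X^* \h (X \h Z))
    \v (\id_L \hh cone_at (p X) Z) \v assl L L Z.
Proof.
by apply: heq_eq; rewrite !cone_atE ev_atE /ad_mult_cone (hc2_split (p X)); coh.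
Qed.

(** Dinaturality of [p] is used twice: on the inner copy it turns [f] into its mate, [ev_at_mate]
    turns the mate back into [f] across the evaluation, and on the outer copy [f] becomes the mate
    again. *)
Lemma is_dinatural_ad_mult_cone : is_dinatural ad_mult_cone.
Proof.
apply/is_dinatural_at => X Y f D Z; rewrite !ad_mult_cone_at !kcompA.
congr (_ \v _); rewrite -(id_h_comp X^*) -ev_at_nat.
rewrite (id_h_comp X^*) -(kcompA _ (_ \hh _) (cone_at _ _)) -cone_at_nat !kcompA.
rewrite -(kcompA _ (\id_L \hh _)) -(id_h_comp L) ad_dinatural_at (id_h_comp L).
rewrite !kcompA -(kcompA _ (cone_at _ _)) cone_at_nat kcompA -(id_h_comp X^*).
rewrite ev_at_mate (id_h_comp X^*) -(kcompA _ (_ \hh _) (cone_at _ _)).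
by rewrite ad_dinatural_at kcompA -hc2_swap.
Qed.

End Multiplication.

Lemma ad_mult_exists A :
  exists m : Ad A \h Ad A ~~> Ad A, unique (is_ad_mult (A := A)) m.
Proof. by have [_] := ad_end Ad A; apply; apply: is_dinatural_ad_mult_cone. Qed.

Lemma ad_unit_exists A :
  exists u : \I_A ~~> Ad A, unique (is_ad_unit (A := A)) u.
Proof. by have [_] := ad_end Ad A; apply; apply: is_dinatural_coev. Qed.

(** * Testing 2-cells into X L(C, b) through the half-braiding *)

Section BraidedCone.
Variables (A C : B) (X : hcat B C A).

(** The p_(YX) occurring in [ad_br], with the dual of the composite split into X' Y'. *)
Definition ad_cone_comp_at (Y : hcat B A b) D (Z : hcat B D C) :
    Ad C \h Z ~~> X^* \h (Y^* \h (Y \h (X \h Z))) :=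
  locked (ldual_comp_at ld Y X (Y \h (X \h Z)) \v (\id_(Y \h X)^* \hh assl Y X Z)
    \v cone_at (p (Y \h X)) Z).

Lemma ad_cone_comp_atE (Y : hcat B A b) D (Z : hcat B D C) :
  ad_cone_comp_at Y Z =
  ldual_comp_at ld Y X (Y \h (X \h Z)) \v (\id_(Y \h X)^* \hh assl Y X Z)
    \v cone_at (p (Y \h X)) Z.
Proof. by rewrite /ad_cone_comp_at -lock. Qed.

Lemma ad_br_at (Y : hcat B A b) D (Z : hcat B D C) :
  ev_at (ld X) (Y^* \h (Y \h (X \h Z))) \v (\id_X \hh ad_cone_comp_at Y Z)
    \v br_at Ad X Z =
  cone_at (p Y) (X \h Z).
Proof.
rewrite ad_cone_comp_atE ldual_comp_atD cone_atE ev_atE br_atE cone_atE.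
apply: (eq_hom_conj _ (congr1 (fun f => f \hh \id_Z) (esym (ad_br Ad X Y))) _).
  coh.
coh.
Qed.

Lemma ad_half_braiding_jointly_mono (M : hcat B C A) (g h : M ~~> X \h Ad C) :
  (forall (Y : hcat B A b) D (Z : hcat B D C),
    ev_at (ld X) (Y^* \h (Y \h (X \h Z))) \v (\id_X \hh ad_cone_comp_at Y Z)
      \v (assl X (Ad C) Z \v (g \hh \id_Z)) =
    ev_at (ld X) (Y^* \h (Y \h (X \h Z))) \v (\id_X \hh ad_cone_comp_at Y Z)
      \v (assl X (Ad C) Z \v (h \hh \id_Z))) ->
  g = h.
Proof.
move=> e; have [s [sK Ks]] := zbr_iso Ad X.
suff : s \v g = s \v h.
  by move/(congr1 (kcomp (zbr Ad X))); rewrite !kcompA Ks !kcomp1l.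
apply: ad_proj_whiskerr_jointly_mono => Y.
apply: whiskerr_faithful => D Z.
have E (k : M ~~> X \h Ad C) :
    ((p Y \hh \id_X) \v (s \v k)) \hh \id_Z =
    assr (Y^* \h Y) X Z \v assr Y^* Y (X \h Z)
      \v (ev_at (ld X) (Y^* \h (Y \h (X \h Z))) \v (\id_X \hh ad_cone_comp_at Y Z)
      \v (assl X (Ad C) Z \v (k \hh \id_Z))).
  (* Writing [k] as the half-braiding after [s \v k] lets [ad_br_at] turn the tested composite into
     a projection [p Y]. *)
  have -> : assl X (Ad C) Z \v (k \hh \id_Z) =
      br_at Ad X Z \v (assl (Ad A) X Z \v ((s \v k) \hh \id_Z)).
    rewrite br_atE -!kcompA (kcompA (assr (Ad A) X Z)) asslK kcomp1l.
    by rewrite -comp_h_id kcompA Ks kcomp1l.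
  rewrite (kcompA _ (br_at Ad X Z)) ad_br_at.
  by apply: heq_eq; rewrite cone_atE (comp_h_id _ (p Y \hh _)); coh.
by rewrite !E e.
Qed.

End BraidedCone.

(** * Product and unit as actions, and their composites with the projections *)

Section Algebra.
Variables (m : forall A, Ad A \h Ad A ~~> Ad A) (u : forall A, \I_A ~~> Ad A).
Hypothesis m_mult : forall A, is_ad_mult (m A).
Hypothesis u_unit : forall A, is_ad_unit (u A).

Definition mult_at A D (Z : hcat B D A) : Ad A \h (Ad A \h Z) ~~> Ad A \h Z :=
  locked ((m A \hh \id_Z) \v assr (Ad A) (Ad A) Z).

Lemma mult_atE A D (Z : hcat B D A) :
  mult_at Z = (m A \hh \id_Z) \v assr (Ad A) (Ad A) Z.
Proof. by rewrite /mult_at -lock. Qed.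

Lemma mult_at_nat A D (Z Z' : hcat B D A) (g : Z ~~> Z') :
  mult_at Z' \v (\id_(Ad A) \hh (\id_(Ad A) \hh g)) =
  (\id_(Ad A) \hh g) \v mult_at Z.
Proof. by rewrite !mult_atE -kcompA assr_nat !kcompA hc2_id hc2_swap. Qed.

Definition unit_at A D (Z : hcat B D A) : Z ~~> Ad A \h Z :=
  locked ((u A \hh \id_Z) \v l1i Z).

Lemma unit_atE A D (Z : hcat B D A) : unit_at Z = (u A \hh \id_Z) \v l1i Z.
Proof. by rewrite /unit_at -lock. Qed.

Lemma unit_at_nat A D (Z Z' : hcat B D A) (g : Z ~~> Z') :
  unit_at Z' \v g = (\id_(Ad A) \hh g) \v unit_at Z.
Proof. by rewrite !unit_atE -kcompA l1i_nat !kcompA hc2_swap. Qed.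

Lemma cone_mult_at A (X : hcat B A b) D (Z : hcat B D A) :
  cone_at (p X) Z \v mult_at Z =
  (\id_X^* \hh ev_at (ld X) (X \h Z)) \v cone_at (p X) (X^* \h (X \h Z))
    \v (\id_(Ad A) \hh cone_at (p X) Z).
Proof.
rewrite cone_atE mult_atE kcompA -(kcompA (assl _ _ _)) -comp_h_id m_mult.
have := ad_mult_cone_at X Z; rewrite cone_atE => ->.
by rewrite -kcompA assrK kcompl1 !cone_atE.
Qed.

Lemma cone_unit_at A (X : hcat B A b) D (Z : hcat B D A) :
  cone_at (p X) Z \v unit_at Z = coev_at (ld X) Z.
Proof.
rewrite cone_atE unit_atE kcompA -(kcompA (assl _ _ _)) -comp_h_id u_unit.
by rewrite coev_atE.
Qed.

(** The product at [Y \h X] involves the evaluation of [Y \h X], which the comparison of duals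
    replaces by those of [X] and [Y]; hence both copies of the projection appear in split form. *)
Lemma cone_comp_mult_at A C (X : hcat B C A) (Y : hcat B A b) D (Z : hcat B D C) :
  ad_cone_comp_at X Y Z \v mult_at Z =
  (\id_X^* \hh (\id_Y^* \hh (ev_at (ld Y) (Y \h (X \h Z))
      \v (\id_Y \hh ev_at (ld X) (Y^* \h (Y \h (X \h Z)))))))
    \v ad_cone_comp_at X Y (X^* \h (Y^* \h (Y \h (X \h Z))))
    \v (\id_(Ad C) \hh ad_cone_comp_at X Y Z).
Proof.
set E := ev_at (ld Y) _ \v _.
(* This is [ev_ldual_comp_at], with its argument rebracketed by naturality of the evaluation. *)
have W'E : assl Y X Z \v ev_at (ld (Y \h X)) ((Y \h X) \h Z) =
    E \v assl Y X _ \v (\id_(Y \h X) \hh (ldual_comp_at ld Y X (Y \h (X \h Z))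
      \v (\id_(Y \h X)^* \hh assl Y X Z))).
  rewrite (id_h_comp (Y \h X)) kcompA -(kcompA E) -hc2_id assl_nat kcompA.
  by rewrite ev_ldual_comp_at -(kcompA _ _ (assl _ _ _)) asslK kcompl1 hc2_id ev_at_nat.
rewrite {1}ad_cone_comp_atE -!kcompA cone_mult_at !kcompA.
rewrite -(kcompA (ldual_comp_at _ _ _ _)) -!(id_h_comp (Y \h X)^*) W'E.
rewrite (id_h_comp _ (E \v _)) kcompA -(kcompA _ _ (cone_at _ _)) -cone_at_nat.
rewrite (id_h_comp _ E) !kcompA ldual_comp_at_nat.
rewrite -(kcompA _ (\id_(Ad C) \hh _)) -(id_h_comp (Ad C)) -ad_cone_comp_atE.
by rewrite (ad_cone_comp_atE X Y (X^* \h _)) !kcompA.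
Qed.

Lemma cone_comp_unit_at A C (X : hcat B C A) (Y : hcat B A b) D (Z : hcat B D C) :
  ad_cone_comp_at X Y Z \v unit_at Z =
  (\id_X^* \hh coev_at (ld Y) (X \h Z)) \v coev_at (ld X) Z.
Proof.
by rewrite ad_cone_comp_atE -kcompA cone_unit_at ldual_comp_coev_at.
Qed.

(** * Compatibility of product and unit with the half-braiding *)

Lemma mult_br A C (X : hcat B A C) :
  (\id_X \hh m A) \v zbr (zten Ad Ad) X = zbr Ad X \v (m C \hh \id_X).
Proof.
apply: ad_half_braiding_jointly_mono => Y D Z.
have -> : assl X (Ad A) Z \v (((\id_X \hh m A) \v zbr (zten Ad Ad) X) \hh \id_Z) =
    (\id_X \hh mult_at Z) \v br_at Ad X (Ad A \h Z) \v (\id_(Ad C) \hh br_at Ad X Z)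
      \v (assl (Ad C) (Ad C) (X \h Z) \v assl (Ad C \h Ad C) X Z).
  by apply: heq_eq; rewrite comp_h_id [zbr _ _]/= br_at_ten mult_atE; coh.
have -> : assl X (Ad A) Z \v ((zbr Ad X \v (m C \hh \id_X)) \hh \id_Z) =
    br_at Ad X Z \v mult_at (X \h Z)
      \v (assl (Ad C) (Ad C) (X \h Z) \v assl (Ad C \h Ad C) X Z).
  by apply: heq_eq; rewrite br_atE mult_atE; coh.
rewrite !kcompA ad_br_at cone_mult_at; do 2!congr (_ \v _).
(* The left side acquires a split projection and a half-braiding for each factor; the outer pair
   contracts to [p Y] by [ad_br_at]. *)
rewrite -(kcompA _ (\id_X \hh ad_cone_comp_at _ _ _)) -(id_h_comp X).
rewrite cone_comp_mult_at !(id_h_comp X) !kcompA ev_at_nat.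
rewrite -(kcompA _ (\id_X \hh (\id_(Ad A) \hh _)) (br_at _ _ _)) -br_at_nat.
rewrite !kcompA -!(kcompA (\id_Y^* \hh _)) ad_br_at (id_h_comp Y^*).
(* On the right the inner [p Y] is expanded by the same identity, and the resulting evaluation of
   [X] passes the outer [p Y] by naturality. *)
rewrite -(ad_br_at X Y Z) !(id_h_comp (Ad C)) !kcompA.
rewrite -!(kcompA _ (cone_at _ _) (\id_(Ad C) \hh ev_at _ _)) cone_at_nat.
by rewrite !kcompA.
Qed.

Lemma unit_br A C (X : hcat B A C) :
  (\id_X \hh u A) \v zbr (zone B) X = zbr Ad X \v (u C \hh \id_X).
Proof.
apply: ad_half_braiding_jointly_mono => Y D Z.
have -> : assl X (Ad A) Z \v (((\id_X \hh u A) \v zbr (zone B) X) \hh \id_Z) =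
    (\id_X \hh unit_at Z) \v (l1 (X \h Z) \v assl (\I_C) X Z).
  by apply: heq_eq; rewrite unit_atE /= /zone_br; coh.
have -> : assl X (Ad A) Z \v ((zbr Ad X \v (u C \hh \id_X)) \hh \id_Z) =
    br_at Ad X Z \v unit_at (X \h Z) \v (l1 (X \h Z) \v assl (\I_C) X Z).
  by apply: heq_eq; rewrite br_atE unit_atE; coh.
rewrite !kcompA ad_br_at cone_unit_at; do 2!congr (_ \v _).
(* Naturality moves the evaluation of [X] past the coevaluation of [Y], where it cancels the
   coevaluation of [X]. *)
rewrite -kcompA -id_h_comp cone_comp_unit_at id_h_comp kcompA ev_at_nat.
by rewrite -kcompA ev_coev_at kcompl1.
Qed.

(** * Associativity and unit laws on components *)

Lemma mult_assoc A :
  m A \v (m A \hh \id_(Ad A)) =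
  m A \v ((\id_(Ad A) \hh m A) \v assl (Ad A) (Ad A) (Ad A)).
Proof.
apply: ad_proj_jointly_mono => X; apply: whiskerr_faithful => D Z.
rewrite !(comp_h_id _ (p X)).
have -> : (m A \v (m A \hh \id_(Ad A))) \hh \id_Z =
    mult_at Z \v mult_at (Ad A \h Z)
      \v (assl (Ad A) (Ad A) (Ad A \h Z) \v assl (Ad A \h Ad A) (Ad A) Z).
  by apply: heq_eq; rewrite !mult_atE; coh.
have -> : (m A \v ((\id_(Ad A) \hh m A) \v assl (Ad A) (Ad A) (Ad A))) \hh \id_Z =
    mult_at Z \v (\id_(Ad A) \hh mult_at Z)
      \v (assl (Ad A) (Ad A) (Ad A \h Z) \v assl (Ad A \h Ad A) (Ad A) Z).
  by apply: heq_eq; rewrite !mult_atE; coh.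
have -> : p X \hh \id_Z = assr _ _ _ \v cone_at (p X) Z.
  by rewrite cone_atE kcompA asslK kcomp1l.
rewrite !kcompA; do 2!congr (_ \v _).
rewrite -!(kcompA (assr _ _ _)); congr (_ \v _).
(* Both sides become three copies of [p X] followed by two evaluations, whose order is exchanged by
   [ev_at_nat]. *)
rewrite cone_mult_at -!(kcompA _ _ (mult_at _)) -mult_at_nat.
rewrite !kcompA -(kcompA _ (cone_at _ _) (mult_at _)) cone_mult_at !kcompA.
rewrite -(kcompA _ (_ \hh cone_at _ _) (_ \hh mult_at _)) -(id_h_comp (Ad A)).
rewrite cone_mult_at.
rewrite !(id_h_comp (Ad A)) !kcompA.
rewrite -!(kcompA _ (cone_at _ _) (_ \hh (_ \hh ev_at _ _))).
by rewrite cone_at_nat !kcompA -!(id_h_comp X^*) ev_at_nat.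
Qed.

Lemma mult_unitl A : m A \v (u A \hh \id_(Ad A)) = l1 (Ad A).
Proof.
apply: ad_proj_jointly_mono => X; apply: whiskerr_faithful => D Z.
rewrite !(comp_h_id _ (p X)).
have -> : (m A \v (u A \hh \id_(Ad A))) \hh \id_Z =
    mult_at Z \v unit_at (Ad A \h Z) \v (l1 (Ad A) \hh \id_Z).
  by apply: heq_eq; rewrite mult_atE unit_atE; coh.
have -> : p X \hh \id_Z = assr _ _ _ \v cone_at (p X) Z.
  by rewrite cone_atE kcompA asslK kcomp1l.
rewrite !kcompA; congr (_ \v _).
rewrite -!(kcompA (assr _ _ _)); congr (_ \v _).
(* The unit turns the left copy of [p X] into a coevaluation, so the second triangle identity
   applies. *)
rewrite cone_mult_at -kcompA -unit_at_nat kcompA -(kcompA _ (cone_at _ _)).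
by rewrite cone_unit_at coev_ev_at kcomp1l.
Qed.

Lemma mult_unitr A : m A \v (\id_(Ad A) \hh u A) = r1 (Ad A).
Proof.
apply: ad_proj_jointly_mono => X; apply: whiskerr_faithful => D Z.
rewrite !(comp_h_id _ (p X)).
have -> : (m A \v (\id_(Ad A) \hh u A)) \hh \id_Z =
    mult_at Z \v (\id_(Ad A) \hh unit_at Z) \v (r1 (Ad A) \hh \id_Z).
  by apply: heq_eq; rewrite mult_atE unit_atE; coh.
have -> : p X \hh \id_Z = assr _ _ _ \v cone_at (p X) Z.
  by rewrite cone_atE kcompA asslK kcomp1l.
rewrite !kcompA; congr (_ \v _).
rewrite -!(kcompA (assr _ _ _)); congr (_ \v _).
(* Here the right copy becomes the coevaluation, which calls for the first triangle identity. *)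
rewrite cone_mult_at -kcompA -id_h_comp cone_unit_at -kcompA cone_at_nat kcompA.
by rewrite -id_h_comp ev_coev_at hc2_id kcomp1l.
Qed.

End Algebra.

End Adjoint.

(** * The algebra in the center *)

Theorem proposition5p4 (K : closedFieldType) (B : tcat K)
    (finB : is_finite_tcat B)
    (ld : forall (A C : B) (X : hcat B A C), left_dual X)
    (b : B) (Ad : adjoint_object ld b) :
  exists (m : zhom (zten Ad Ad) Ad) (u : zhom (zone B) Ad),
    [/\ forall A : B, unique (is_ad_mult (A := A)) (m A),
        forall A : B, unique (is_ad_unit (A := A)) (u A)
      & is_algebra (M := center B) m u].
Proof.
(* Existence is known for one 0-cell at a time; description selects families indexed by [A]. *)
pose m A := constructive_indefinite_description _ (ad_mult_exists Ad A).
pose u A := constructive_indefinite_description _ (ad_unit_exists Ad A).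
have m_mult A : is_ad_mult (proj1_sig (m A)) by case: (proj2_sig (m A)).
have u_unit A : is_ad_unit (proj1_sig (u A)) by case: (proj2_sig (u A)).
exists (@ZHom _ _ (zten Ad Ad) Ad (fun A => proj1_sig (m A)) (mult_br m_mult)).
exists (@ZHom _ _ (zone B) Ad (fun A => proj1_sig (u A)) (unit_br u_unit)).
split=> [A|A|]; [exact: (proj2_sig (m A)) | exact: (proj2_sig (u A)) | split].
(* Morphisms of the center are compared on components, where its associator and unit constraints are
   [assl], [l1] and [r1]. *)
- by apply: zhom_ext => A; apply: mult_assoc.
- by apply: zhom_ext => A; apply: mult_unitl.
- by apply: zhom_ext => A; apply: mult_unitr.
Qed.
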